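(* Every non-empty complemented subset of the ordinal $\mathrm K\nu$ has a least element, for any $\nu:\mathrm E$. That is, for every $p:\mathrm K\nu\to\mathbf 2$ with $\neg\neg\,\Sigma_x\,(p\,x=0)$ there is a point $x_0$ with $p\,x_0=0$ and $x_0\le x$ for every $x$ with $p\,x=0$.
   Context: Foundation: intensional Martin-Löf type theory as in the HoTT Book, with $\mathbf 0$, $\mathbf 1$ (point $\star$), $\mathbf 2$ (points $0,1$), $\mathbb N$, $+$, $\Pi$, $\Sigma$, universes, univalence (hence function extensionality), propositional truncation, set quotients, and inductive-recursive definitions. No excluded middle is assumed. $f^{-1}(y):=\Sigma_x(f\,x=y)$; an embedding is a map all of whose fibers are propositions (types with at most one element). A complemented subset of $X$ is given by its characteristic function $p:X\to\mathbf 2$, whose roots (points with $p\,x=0$) are its elements; it is non-empty if its type of elements is not empty (doubly negated existence). For an ordinal, the weak order is $x\le y:\equiv\neg(y<x)$. A least element is a member that is $\le$ all members. Ordinals. An ordinal is a type with a proposition-valued, transitive, extensional (elements with the same predecessors are equal), well-founded relation $<$; the same symbol denotes an ordinal and its underlying type. $\mathbf 1$ is an ordinal with the empty order. A topped ordinal is an ordinal with a specified point $t$ such that $\neg(t<y)$ for all $y$; $\mathrm{Ord}^\top$ is their type. For a topped ordinal $\tau$ and $\upsilon:\tau\to\mathrm{Ord}^\top$, $\Sigma_\tau\upsilon$ is the topped ordinal $\Sigma_{x:\tau}\upsilon\,x$ with the lexicographic order: $(x,a)<(x',a')$ iff $x<x'$, or there is $r:x=x'$ such that the transport of $a$ along $r$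 is below $a'$; its top is the pair of tops. The sum $\tau+\upsilon$ of topped ordinals is the lexicographic sum, over the two-point topped ordinal with underlying type $\mathbf 1+\mathbf 1$ and $\mathrm{inl}\,\star<\mathrm{inr}\,\star$, of the family with members $\tau,\upsilon$; its points are pairs $(\mathrm{inl}\,\star,x)$ or $(\mathrm{inr}\,\star,y)$. The topped ordinal $\omega+\mathbf 1$ is $\mathbb N+\mathbf 1$ with the usual order on $\mathbb N$ and the added point as top, above all $\mathrm{inl}\,n$. Conaturals: $\mathbb N_\infty:=\Sigma_{u:\mathbf 2^{\mathbb N}}\prod_i u_{i+1}\le u_i$; $\underline n$ is $n$ ones followed by zeros; $\infty$ is constantly $1$. It is a topped ordinal with top $\infty$ under $u<v:\equiv\Sigma_{n:\mathbb N}(u=\underline n)\times(v_n=1)$. $\iota_1:\mathbb N+\mathbf 1\hookrightarrow\mathbb N_\infty$ sends $\mathrm{inl}\,n$ to $\underline n$ and the added point to $\infty$. Extension: for an embedding $j:X\hookrightarrow K$ and $\alpha:X\to\mathrm{Ord}^\top$, $(\alpha/j)\,k:=\prod_{(x,p):j^{-1}(k)}\alpha\,x$ with order $u<v:\equiv\Sigma_{p:j^{-1}(k)}\,u\,p<v\,p$ and top the function assigning tops. Evaluation at $(x,\mathrm{refl})$ is an order equivalence $(\alpha/j)(j\,x)\simeq\alpha\,x$. Codes. $\mathrm E$ and $\Delta:\mathrm E\to\mathrm{Ord}^\top$ are defined simultaneously by induction-recursion. Constructors of $\mathrm E$: $\ulcorner\mathbf 1\urcorner$; $\ulcorner\omega+\mathbf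 1\urcorner$; $\nu_0\,\ulcorner+\urcorner\,\nu_1$ and $\nu_0\,\ulcorner\times\urcorner\,\nu_1$ for $\nu_0,\nu_1:\mathrm E$; $\ulcorner\Sigma\urcorner\,\nu\,A$ for $\nu:\mathrm E$ and $A:\Delta\nu\to\mathrm E$. $\Delta\ulcorner\mathbf 1\urcorner=\mathbf 1$; $\Delta\ulcorner\omega+\mathbf 1\urcorner=\omega+\mathbf 1$; $\Delta(\nu_0\,\ulcorner+\urcorner\,\nu_1)=\Delta\nu_0+\Delta\nu_1$; $\Delta(\nu_0\,\ulcorner\times\urcorner\,\nu_1)=\Sigma_{\Delta\nu_0}(\lambda\_.\,\Delta\nu_1)$; $\Delta(\ulcorner\Sigma\urcorner\,\nu\,A)=\Sigma_{\Delta\nu}(\Delta\circ A)$. Simultaneously by induction on codes one defines $\mathrm K:\mathrm E\to\mathrm{Ord}^\top$ and $\iota_\nu:\Delta\nu\to\mathrm K\nu$ and proves that $\iota_\nu$ is an embedding: $\mathrm K\ulcorner\mathbf 1\urcorner=\mathbf 1$; $\mathrm K\ulcorner\omega+\mathbf 1\urcorner=\mathbb N_\infty$; $\mathrm K(\nu_0\,\ulcorner+\urcorner\,\nu_1)=\mathrm K\nu_0+\mathrm K\nu_1$; $\mathrm K(\nu_0\,\ulcorner\times\urcorner\,\nu_1)=\Sigma_{\mathrm K\nu_0}(\lambda\_.\,\mathrm K\nu_1)$; $\mathrm K(\ulcorner\Sigma\urcorner\,\nu\,A)=\Sigma_{\mathrm K\nu}\big((\mathrm K\circ A)/\iota_\nu\big)$;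 and $\iota_{\ulcorner\mathbf 1\urcorner}=\mathrm{id}$; $\iota_{\ulcorner\omega+\mathbf 1\urcorner}=\iota_1$; $\iota_{\nu_0\ulcorner+\urcorner\nu_1}(\mathrm{inl}\,\star,y)=(\mathrm{inl}\,\star,\iota_{\nu_0}y)$, $\iota_{\nu_0\ulcorner+\urcorner\nu_1}(\mathrm{inr}\,\star,y)=(\mathrm{inr}\,\star,\iota_{\nu_1}y)$; $\iota_{\nu_0\ulcorner\times\urcorner\nu_1}(x,y)=(\iota_{\nu_0}x,\iota_{\nu_1}y)$; $\iota_{\ulcorner\Sigma\urcorner\nu A}(x,z)=(\iota_\nu x,\varphi_x^{-1}(\iota_{A\,x}z))$, where $\varphi_x:((\mathrm K\circ A)/\iota_\nu)(\iota_\nu x)\simeq\mathrm K(A\,x)$ is evaluation at $(x,\mathrm{refl})$. *)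

(* Defs.v *)
(* The identity type is [eq]: it lives in [Prop], but it eliminates into all
   sorts, and neither proof irrelevance nor UIP is assumed.  "Proposition" means
   [is_prop], at most one element, and not membership in the sort [Prop].  The
   only axiom used is function extensionality.  The points 0 and 1 of the type 2
   are [false] and [true]. *)
From Stdlib Require Import Arith Lia Bool Eqdep_dec FunctionalExtensionality.
Import EqNotations.

Set Implicit Arguments.
Unset Strict Implicit.
Unset Printing Implicit Defensive.

Definition is_prop (A : Type) : Prop := forall a b : A, a = b.
Definition is_set (A : Type) : Prop := forall a b : A, is_prop (a = b).

Definition fiber (X Y : Type) (f : X -> Y) (y : Y) : Type := {x : X & f x = y}.
Definition is_embedding (X Y : Type) (f : X -> Y) : Prop :=
  forall y : Y, is_prop (fiber f y).

(* The library's [Acc] only takes [Prop]-valued relations. *)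
Inductive acc (X : Type) (R : X -> X -> Type) (x : X) : Type :=
  acc_step : (forall y, R y x -> acc R y) -> acc R x.

Record Ord := {
  carrier :> Type;
  olt : carrier -> carrier -> Type;
  olt_prop : forall x y, is_prop (olt x y);
  olt_trans : forall x y z, olt x y -> olt y z -> olt x z;
  olt_ext : forall x y, (forall z, olt z x -> olt z y) ->
                        (forall z, olt z y -> olt z x) -> x = y;
  olt_wf : forall x, acc olt x }.

Arguments olt {o} _ _.
Infix "≺" := olt (at level 70, no associativity).

Definition ole (X : Ord) (x y : X) := notT (y ≺ x).
Infix "≼" := ole (at level 70, no associativity).

Record TOrd := {
  tord :> Ord;
  otop : tord;
  otop_max : forall y : tord, notT (otop ≺ y) }.

Arguments otop {t}.

Lemma is_prop_forall (A : Type) (B : A -> Type) :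
  (forall x, is_prop (B x)) -> is_prop (forall x, B x).
Proof. intros H f g. apply functional_extensionality_dep. intros x. apply H. Qed.

Lemma is_set_const (X : Type) (f : forall x y : X, x = y -> x = y) :
  (forall x y (p q : x = y), f x y p = f x y q) -> is_set X.
Proof.
  intros Hf x y p q.
  assert (H : forall y (r : x = y), r = eq_trans (eq_sym (f x x eq_refl)) (f x y r)).
  { intros y' r. destruct r. destruct (f x x eq_refl). reflexivity. }
  rewrite (H y p), (H y q), (Hf x y p q). reflexivity.
Qed.

Lemma bool_set : is_set bool.
Proof. intros x y p q. apply UIP_dec. apply bool_dec. Qed.

Lemma ord_set (X : Ord) : is_set X.
Proof.
  set (D := fun x y : X => ((forall z, z ≺ x -> z ≺ y) * (forall z, z ≺ y -> z ≺ x))%type).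
  assert (DP : forall x y, is_prop (D x y)).
  { intros x y [a b] [c d]. f_equal;
    repeat (apply is_prop_forall; intro); apply olt_prop. }
  set (e := fun (x y : X) (p : x = y) =>
    match p in _ = y return D x y with
    | eq_refl => ((fun z h => h), (fun z h => h)) end).
  apply (@is_set_const X (fun x y p => olt_ext (fst (e x y p)) (snd (e x y p)))).
  intros x y p q. rewrite (DP _ _ (e x y p) (e x y q)). reflexivity.
Qed.

Lemma olt_irrefl (X : Ord) (x : X) : notT (x ≺ x).
Proof.
  intros h. generalize h. induction (olt_wf x) as [x _ IH]. exact (IH x h h).
Qed.

Lemma embedding_inj (X Y : Type) (f : X -> Y) (x y : X) :
  is_embedding f -> f x = f y -> x = y.
Proof.
  intros E p.
  exact (f_equal (@projT1 _ _) (E (f y) (existT _ x p) (existT _ y eq_refl))).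
Qed.

Lemma inj_embedding (X Y : Type) (f : X -> Y) :
  is_set Y -> (forall x y, f x = f y -> x = y) -> is_embedding f.
Proof.
  intros S I y [a p] [b q].
  assert (r : a = b) by (apply I; congruence).
  destruct r. f_equal. apply S.
Qed.

Definition one_ord : Ord.
Proof.
  refine {| carrier := unit; olt := fun _ _ => Empty_set |}.
  - intros x y [].
  - intros x y z [].
  - intros [] [] _ _. reflexivity.
  - intros x. constructor. intros y [].
Defined.

Definition one_tord : TOrd.
Proof. exists one_ord tt. intros y []. Defined.

Definition two_lt (x y : unit + unit) : Type :=
  match x, y with inl _, inr _ => unit | _, _ => Empty_set end.

Definition two_ord : Ord.
Proof.
  refine {| carrier := unit + unit; olt := two_lt |}.
  - intros [x|x] [y|y] a b; destruct a, b; reflexivity.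
  - intros [x|x] [y|y] [z|z] a b; destruct a, b; exact tt.
  - intros [[]|[]] [[]|[]] a b; try reflexivity.
    + destruct (b (inl tt) tt).
    + destruct (a (inl tt) tt).
  - assert (A : forall u, acc two_lt (inl u)).
    { intros u. constructor. intros [y|y] []. }
    intros [x|x]; [apply A|]. constructor. intros [y|y] []. apply A.
Defined.

Definition two_tord : TOrd.
Proof. exists two_ord (inr tt). intros [y|y] []. Defined.

Definition omega1_lt (x y : nat + unit) : Type :=
  match x, y with
  | inl m, inl n => m < n
  | inl _, inr _ => unit
  | inr _, _ => Empty_set
  end.

Definition omega1_ord : Ord.
Proof.
  refine {| carrier := nat + unit; olt := omega1_lt |}.
  - intros [x|x] [y|y] a b; try destruct a, b; try reflexivity.
    apply Peano_dec.le_unique.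
  - intros [x|x] [y|y] [z|z] a b; cbn in *; try destruct a; try destruct b;
      try exact tt; lia.
  - intros [x|[]] [y|[]] a b; try reflexivity.
    + f_equal. destruct (lt_eq_lt_dec x y) as [[h|h]|h]; auto.
      * specialize (b (inl x) h). cbn in b. lia.
      * specialize (a (inl y) h). cbn in a. lia.
    + specialize (b (inl x) tt). cbn in b. lia.
    + specialize (a (inl y) tt). cbn in a. lia.
  - assert (A : forall n, acc omega1_lt (inl n)).
    { intros n. induction n as [n IH] using lt_wf_rect.
      constructor. intros [m|m] h; [apply IH; exact h|destruct h]. }
    intros [x|x]; [apply A|]. constructor. intros [y|y] []. apply A.
Defined.

Definition omega1_tord : TOrd.
Proof. exists omega1_ord (inr tt). intros [y|y] []. Defined.

Definition decreasing (u : nat -> bool) : Prop := forall i, Bool.le (u (S i)) (u i).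
Definition conat : Type := {u : nat -> bool & decreasing u}.
Definition bits (u : conat) : nat -> bool := projT1 u.

Lemma decreasing_prop (u : nat -> bool) : is_prop (decreasing u).
Proof.
  apply is_prop_forall. intros i. unfold Bool.le. destruct (u (S i)).
  - apply bool_set.
  - intros [] []. reflexivity.
Qed.

Lemma conat_eq (u v : conat) : (forall i, bits u i = bits v i) -> u = v.
Proof.
  destruct u as [u Hu], v as [v Hv]; cbn. intros H.
  apply functional_extensionality in H. destruct H.
  f_equal. apply decreasing_prop.
Qed.

Lemma conat_set : is_set conat.
Proof.
  apply (@is_set_const conat
    (fun u v p => conat_eq (fun i => f_equal (fun w => bits w i) p))).
  intros u v p q. f_equal. apply is_prop_forall. intros i. apply bool_set.
Qed.

Lemma bits_mono (u : conat) m n : m <= n -> bits u n = true -> bits u m = true.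
Proof.
  induction 1 as [|n _ IH]; auto. intros h. apply IH.
  generalize (projT2 u n). fold (bits u). unfold Bool.le. rewrite h. auto.
Qed.

Definition fin (n : nat) : conat.
Proof.
  exists (fun i => i <? n). intros i. unfold Bool.le.
  destruct (Nat.ltb_spec (S i) n); auto. apply Nat.ltb_lt. lia.
Defined.

Definition infty : conat.
Proof. exists (fun _ => true). intros i. reflexivity. Defined.

Lemma bits_fin n i : bits (fin n) i = true <-> i < n.
Proof. apply Nat.ltb_lt. Qed.

Lemma fin_inj m n : fin m = fin n -> m = n.
Proof.
  intros h.
  assert (H : forall i, i < m <-> i < n).
  { intros i. rewrite <- !bits_fin, h. tauto. }
  generalize (H m) (H n). lia.
Qed.

Definition conat_lt (u v : conat) : Type :=
  {n : nat & ((u = fin n) * (bits v n = true))%type}.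

Definition conat_ord : Ord.
Proof.
  refine {| carrier := conat; olt := conat_lt |}.
  - intros u v [n [a b]] [m [c d]].
    assert (e : n = m) by (apply fin_inj; congruence). destruct e.
    rewrite (conat_set a c), (bool_set b d). reflexivity.
  - intros u v w [n [-> b]] [m [-> d]].
    exists n. split; [reflexivity|]. apply bits_fin in b.
    apply (@bits_mono w n m); auto; lia.
  - intros u v a b. apply conat_eq. intros i. apply eq_true_iff_eq. split; intros h.
    + destruct (a (fin i)) as [n [e f]]; [exists i; auto|].
      apply fin_inj in e. congruence.
    + destruct (b (fin i)) as [n [e f]]; [exists i; auto|].
      apply fin_inj in e. congruence.
  - assert (A : forall n, acc conat_lt (fin n)).
    { intros n. induction n as [n IH] using lt_wf_rect.
      constructor. intros u [m [-> h]]. apply IH, bits_fin, h. }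
    intros u. constructor. intros v [n [-> _]]. apply A.
Defined.

Definition conat_tord : TOrd.
Proof.
  exists conat_ord infty. intros y [n [e _]].
  assert (h : bits (fin n) n = true) by (rewrite <- e; reflexivity).
  apply bits_fin in h. lia.
Defined.

Definition iota1 (x : omega1_tord) : conat_tord :=
  match x with inl n => fin n | inr _ => infty end.

Lemma iota1_embedding : is_embedding iota1.
Proof.
  apply inj_embedding; [exact conat_set|].
  assert (A : forall n, fin n <> infty).
  { intros n e. assert (h : bits (fin n) n = true) by (rewrite e; reflexivity).
    apply bits_fin in h. lia. }
  intros [m|[]] [n|[]]; cbn; intros e.
  - f_equal. apply fin_inj, e.
  - destruct (A m e).
  - destruct (A n (eq_sym e)).
  - reflexivity.
Qed.

Section Sum.
Variables (T : TOrd) (U : T -> TOrd).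

Definition sum_lt (s s' : {x : T & U x}) : Type :=
  ((projT1 s ≺ projT1 s') +
   {r : projT1 s = projT1 s' & rew [fun x => U x] r in projT2 s ≺ projT2 s'})%type.

Lemma olt_top (x : T) (a : U x) (y : T) (b : U y) (r : x = y) :
  a = otop -> notT (rew [fun x => U x] r in a ≺ b).
Proof. destruct r; cbn. intros ->. apply otop_max. Qed.

Definition sum_ord : Ord.
Proof.
  refine {| carrier := {x : T & U x}; olt := sum_lt |}.
  - intros [x a] [y b] [h|[r h]] [k|[s k]]; cbn in *.
    + f_equal. apply olt_prop.
    + destruct s. destruct (olt_irrefl h).
    + destruct r. destruct (olt_irrefl k).
    + destruct (ord_set r s). do 2 f_equal. apply olt_prop.
  - intros [x a] [y b] [z c] [h|[r h]] [k|[s k]]; cbn in *.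
    + left. cbn. exact (olt_trans h k).
    + left. cbn. destruct s. exact h.
    + left. cbn. destruct r. exact k.
    + right. cbn. exists (eq_trans r s). destruct r, s; cbn in *.
      exact (olt_trans h k).
  - intros [x a] [y b] h k.
    assert (e : x = y).
    { apply olt_ext; intros z l.
      - destruct (h (existT _ z otop) (inl l)) as [m|[r m]]; cbn in *; [exact m|].
        destruct (olt_top eq_refl m).
      - destruct (k (existT _ z otop) (inl l)) as [m|[r m]]; cbn in *; [exact m|].
        destruct (olt_top eq_refl m). }
    destruct e. f_equal. apply olt_ext; intros c l.
    + destruct (h (existT _ x c)) as [m|[r m]]; cbn in *.
      * right. exists eq_refl. exact l.
      * destruct (olt_irrefl m).
      * rewrite (ord_set r eq_refl) in m. exact m.
    + destruct (k (existT _ x c)) as [m|[r m]]; cbn in *.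
      * right. exists eq_refl. exact l.
      * destruct (olt_irrefl m).
      * rewrite (ord_set r eq_refl) in m. exact m.
  - intros [x a]. revert a. induction (olt_wf x) as [x _ IHx].
    intros a. induction (olt_wf a) as [a _ IHa].
    constructor. intros [y b] [h|[r h]]; cbn in *.
    + exact (IHx y h b).
    + destruct r. exact (IHa b h).
Defined.

Definition sum_tord : TOrd.
Proof.
  exists sum_ord (existT _ otop otop). intros [y b] [h|[r h]]; cbn in *.
  - exact (otop_max h).
  - exact (olt_top eq_refl h).
Defined.

End Sum.

Definition two_family (T U : TOrd) (i : two_tord) : TOrd :=
  match i with inl _ => T | inr _ => U end.
Definition plus_tord (T U : TOrd) : TOrd := sum_tord (two_family T U).
Definition times_tord (T U : TOrd) : TOrd := sum_tord (fun _ : T => U).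

Section Extension.
Variables (X K : Type) (j : X -> K) (J : is_embedding j) (F : X -> TOrd).

(* With [k : K], the types below make up the topped ordinal (F / j) k. *)
Definition ext_carrier (k : K) : Type := forall q : fiber j k, F (projT1 q).

Definition ext_lt (k : K) (u v : ext_carrier k) : Type := {q : fiber j k & u q ≺ v q}.

Lemma fiber_set (k : K) : is_set (fiber j k).
Proof. apply (@is_set_const _ (fun x y _ => J x y)). reflexivity. Qed.

(* Fibres of [j] are propositions, so an element of [ext_carrier k] is
   determined by its value at any one point [q] of the fibre. *)
Definition fiber_tr (k : K) (q : fiber j k) (a : F (projT1 q)) : ext_carrier k :=
  fun q' => rew [fun q => F (projT1 q)] (J q q') in a.

Lemma fiber_tr_at (k : K) (q : fiber j k) (a : F (projT1 q)) : fiber_tr a q = a.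
Proof. unfold fiber_tr. rewrite (fiber_set (J q q) eq_refl). reflexivity. Qed.

Definition ext_ord (k : K) : Ord.
Proof.
  refine {| carrier := ext_carrier k; olt := @ext_lt k |}.
  - intros u v [q h] [q' h']. destruct (J q q'). f_equal. apply olt_prop.
  - intros u v w [q h] [q' h']. destruct (J q q'). exists q. exact (olt_trans h h').
  - intros u v h h'. apply functional_extensionality_dep. intros q.
    apply olt_ext; intros a l.
    + destruct (h (fiber_tr a)) as [q' m].
      * exists q. rewrite fiber_tr_at. exact l.
      * destruct (J q q'). rewrite fiber_tr_at in m. exact m.
    + destruct (h' (fiber_tr a)) as [q' m].
      * exists q. rewrite fiber_tr_at. exact l.
      * destruct (J q q'). rewrite fiber_tr_at in m. exact m.
  - assert (A : forall (q : fiber j k) (a : F (projT1 q)), acc olt a ->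
                forall u : ext_carrier k, u q = a -> acc (@ext_lt k) u).
    { intros q a Ha. induction Ha as [a _ IH]. intros u <-.
      constructor. intros v [q' h]. destruct (J q q'). exact (IH (v q) h v eq_refl). }
    intros u. constructor. intros v [q _]. exact (A q (v q) (olt_wf (v q)) v eq_refl).
Defined.

Definition ext_tord (k : K) : TOrd.
Proof. exists (ext_ord k) (fun _ => otop). intros y [q h]. exact (otop_max h). Defined.

(* [ext_eval x] is the order equivalence phi_x, with inverse [ext_eval_inv x]. *)

Definition ext_eval (x : X) (u : ext_tord (j x)) : F x :=
  u (existT (fun x' => j x' = j x) x eq_refl).

Definition ext_eval_inv (x : X) (a : F x) : ext_tord (j x) :=
  fiber_tr (q := existT (fun x' => j x' = j x) x eq_refl) a.

Lemma ext_evalK (x : X) (u : ext_tord (j x)) : ext_eval_inv (ext_eval u) = u.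
Proof.
  apply functional_extensionality_dep. intros q. unfold ext_eval_inv, fiber_tr.
  destruct (J (existT (fun x' => j x' = j x) x eq_refl) q). reflexivity.
Qed.

Lemma ext_eval_invK (x : X) (a : F x) : ext_eval (ext_eval_inv a) = a.
Proof. apply (fiber_tr_at (q := existT (fun x' => j x' = j x) x eq_refl)). Qed.

Lemma ext_eval_mono (x : X) (u v : ext_tord (j x)) :
  u ≺ v -> ext_eval u ≺ ext_eval v.
Proof.
  intros [q h].
  assert (H : forall q', u q' ≺ v q') by (intros q'; destruct (J q q'); exact h).
  exact (H (existT (fun x' => j x' = j x) x eq_refl)).
Qed.

Lemma ext_eval_inv_mono (x : X) (a b : F x) :
  a ≺ b -> ext_eval_inv a ≺ ext_eval_inv b.
Proof.
  intros h. exists (existT (fun x' => j x' = j x) x eq_refl).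
  unfold ext_eval_inv. rewrite !fiber_tr_at. exact h.
Qed.

End Extension.

(* The inductive-recursive pair (E, Delta) is encoded by the inductive family of
   its fibres: [Code T] is the type of codes whose decoding is [T].  The
   constructors, the equations for [Delta], and the induction principle with its
   computation rules are derived below, and they all hold by conversion. *)

Inductive Code : TOrd -> Type :=
| Code_one : Code one_tord
| Code_omega1 : Code omega1_tord
| Code_plus T U : Code T -> Code U -> Code (plus_tord T U)
| Code_times T U : Code T -> Code U -> Code (times_tord T U)
| Code_sum (T : TOrd) (U : T -> TOrd) :
    Code T -> (forall x, Code (U x)) -> Code (sum_tord U).

Set Primitive Projections.
Record E := mkE { Delta : TOrd; code : Code Delta }.
Unset Primitive Projections.

Definition E_one : E := mkE Code_one.
Definition E_omega1 : E := mkE Code_omega1.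
Definition E_plus (n0 n1 : E) : E := mkE (Code_plus (code n0) (code n1)).
Definition E_times (n0 n1 : E) : E := mkE (Code_times (code n0) (code n1)).
Definition E_sum (n : E) (A : Delta n -> E) : E :=
  mkE (Code_sum (code n) (fun x => code (A x))).

Lemma Delta_one : Delta E_one = one_tord.
Proof. reflexivity. Qed.
Lemma Delta_omega1 : Delta E_omega1 = omega1_tord.
Proof. reflexivity. Qed.
Lemma Delta_plus n0 n1 : Delta (E_plus n0 n1) = plus_tord (Delta n0) (Delta n1).
Proof. reflexivity. Qed.
Lemma Delta_times n0 n1 : Delta (E_times n0 n1) = times_tord (Delta n0) (Delta n1).
Proof. reflexivity. Qed.
Lemma Delta_sum n (A : Delta n -> E) :
  Delta (E_sum A) = sum_tord (fun x : Delta n => Delta (A x)).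
Proof. reflexivity. Qed.

Section Elimination.
Variable P : E -> Type.
Hypothesis P_one : P E_one.
Hypothesis P_omega1 : P E_omega1.
Hypothesis P_plus : forall n0 n1, P n0 -> P n1 -> P (E_plus n0 n1).
Hypothesis P_times : forall n0 n1, P n0 -> P n1 -> P (E_times n0 n1).
Hypothesis P_sum : forall n (A : Delta n -> E), P n -> (forall x, P (A x)) -> P (E_sum A).

Fixpoint Code_elim (T : TOrd) (c : Code T) : P (mkE c) :=
  match c in Code T return P (mkE c) with
  | Code_one => P_one
  | Code_omega1 => P_omega1
  | Code_plus c0 c1 => P_plus (Code_elim c0) (Code_elim c1)
  | Code_times c0 c1 => P_times (Code_elim c0) (Code_elim c1)
  | @Code_sum T U c a =>
      @P_sum (mkE c) (fun x => mkE (a x)) (Code_elim c) (fun x => Code_elim (a x))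
  end.

Definition E_elim (n : E) : P n := Code_elim (code n).

Lemma E_elim_one : E_elim E_one = P_one.
Proof. reflexivity. Qed.
Lemma E_elim_omega1 : E_elim E_omega1 = P_omega1.
Proof. reflexivity. Qed.
Lemma E_elim_plus n0 n1 : E_elim (E_plus n0 n1) = P_plus (E_elim n0) (E_elim n1).
Proof. reflexivity. Qed.
Lemma E_elim_times n0 n1 : E_elim (E_times n0 n1) = P_times (E_elim n0) (E_elim n1).
Proof. reflexivity. Qed.
Lemma E_elim_sum n (A : Delta n -> E) :
  E_elim (E_sum A) = P_sum (E_elim n) (fun x => E_elim (A x)).
Proof. reflexivity. Qed.

End Elimination.

Definition sum_map (T : TOrd) (U : T -> TOrd) (T' : TOrd) (U' : T' -> TOrd)
    (f : T -> T') (g : forall x, U x -> U' (f x)) (s : sum_tord U) : sum_tord U' :=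
  existT (fun y => carrier (U' y)) (f (projT1 s)) (g (projT1 s) (projT2 s)).

Lemma sum_eq (T : TOrd) (U : T -> TOrd) (x : T) (a b : U x) :
  existT (fun y => carrier (U y)) x a = existT (fun y => carrier (U y)) x b -> a = b.
Proof.
  intros e. pose proof (projT2_eq e) as h. cbn in h.
  rewrite (ord_set (projT1_eq e) eq_refl) in h. exact h.
Qed.

Lemma sum_map_embedding (T : TOrd) (U : T -> TOrd) (T' : TOrd) (U' : T' -> TOrd)
    (f : T -> T') (g : forall x, U x -> U' (f x)) :
  is_embedding f -> (forall x (a b : U x), g x a = g x b -> a = b) ->
  is_embedding (sum_map g).
Proof.
  intros Hf Hg. apply inj_embedding; [exact (ord_set (X := sum_ord U'))|].
  intros [x a] [y b] e.
  assert (r : x = y) by exact (embedding_inj Hf (f_equal (@projT1 _ _) e)).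
  destruct r. f_equal. apply Hg. exact (sum_eq e).
Qed.

Definition two_map (T U T' U' : TOrd) (f : T -> T') (g : U -> U') (i : two_tord) :
    two_family T U i -> two_family T' U' i :=
  match i with inl _ => f | inr _ => g end.

Lemma id_embedding (X : Type) : is_embedding (fun x : X => x).
Proof. intros y [a p] [b q]. destruct p, q. reflexivity. Qed.

(* K nu, iota_nu and the proof that iota_nu is an embedding have to be produced
   by one induction: for a Sigma code, K is an extension along iota.  The
   equations for K and iota hold by conversion. *)

Record Interp (T : TOrd) := {
  interp_ord : TOrd;
  interp_map : T -> interp_ord;
  interp_emb : is_embedding interp_map }.

Definition Interp_one : Interp one_tord :=
  {| interp_map := fun x => x; interp_emb := id_embedding (X := one_tord) |}.

Definition Interp_omega1 : Interp omega1_tord :=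
  {| interp_map := iota1; interp_emb := iota1_embedding |}.

Definition Interp_plus (T U : TOrd) (I : Interp T) (L : Interp U) :
  Interp (plus_tord T U).
Proof.
  exists (plus_tord (interp_ord I) (interp_ord L))
    (sum_map (U' := two_family (interp_ord I) (interp_ord L)) (f := fun i => i)
       (two_map (@interp_map _ I) (@interp_map _ L))).
  apply sum_map_embedding; [apply id_embedding|].
  intros [i|i] a b; apply embedding_inj, interp_emb.
Defined.

Definition Interp_times (T U : TOrd) (I : Interp T) (L : Interp U) :
  Interp (times_tord T U).
Proof.
  exists (times_tord (interp_ord I) (interp_ord L))
    (sum_map (U' := fun _ => interp_ord L) (f := @interp_map _ I)
       (fun _ => @interp_map _ L)).
  apply sum_map_embedding; [apply interp_emb|].
  intros _ a b; apply embedding_inj, interp_emb.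
Defined.

Definition Interp_sum (T : TOrd) (U : T -> TOrd) (I : Interp T)
  (L : forall x, Interp (U x)) : Interp (sum_tord U).
Proof.
  exists (sum_tord (ext_tord (@interp_emb _ I) (fun x => interp_ord (L x))))
    (sum_map (U' := ext_tord (@interp_emb _ I) (fun x => interp_ord (L x)))
       (f := @interp_map _ I)
       (fun x z => ext_eval_inv (@interp_emb _ I)
                     (F := fun x => interp_ord (L x)) (interp_map (L x) z))).
  apply sum_map_embedding; [apply interp_emb|].
  intros x a b e.
  apply (f_equal (@ext_eval _ _ _ _ _ _)) in e. rewrite !ext_eval_invK in e.
  exact (embedding_inj (@interp_emb _ (L x)) e).
Defined.

Definition interp (n : E) : Interp (Delta n) :=
  E_elim (P := fun n => Interp (Delta n)) Interp_one Interp_omega1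
    (fun _ _ => @Interp_plus _ _) (fun _ _ => @Interp_times _ _)
    (fun _ _ => @Interp_sum _ _) n.

Definition K (n : E) : TOrd := interp_ord (interp n).
Definition iota (n : E) : Delta n -> K n := @interp_map _ (interp n).
Definition iota_embedding (n : E) : is_embedding (@iota n) := @interp_emb _ (interp n).

Arguments iota : clear implicits.

Lemma K_one : K E_one = one_tord.
Proof. reflexivity. Qed.
Lemma K_omega1 : K E_omega1 = conat_tord.
Proof. reflexivity. Qed.
Lemma K_plus n0 n1 : K (E_plus n0 n1) = plus_tord (K n0) (K n1).
Proof. reflexivity. Qed.
Lemma K_times n0 n1 : K (E_times n0 n1) = times_tord (K n0) (K n1).
Proof. reflexivity. Qed.
Lemma K_sum n (A : Delta n -> E) :
  K (E_sum A) = sum_tord (ext_tord (@iota_embedding n) (fun x => K (A x))).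
Proof. reflexivity. Qed.

Lemma iota_one x : iota E_one x = x.
Proof. reflexivity. Qed.
Lemma iota_omega1 x : iota E_omega1 x = iota1 x.
Proof. reflexivity. Qed.
Lemma iota_plus_inl n0 n1 (y : Delta n0) :
  iota (E_plus n0 n1) (existT _ (inl tt) y) = existT _ (inl tt) (iota n0 y).
Proof. reflexivity. Qed.
Lemma iota_plus_inr n0 n1 (y : Delta n1) :
  iota (E_plus n0 n1) (existT _ (inr tt) y) = existT _ (inr tt) (iota n1 y).
Proof. reflexivity. Qed.
Lemma iota_times n0 n1 (x : Delta n0) (y : Delta n1) :
  iota (E_times n0 n1) (existT _ x y) = existT _ (iota n0 x) (iota n1 y).
Proof. reflexivity. Qed.
Lemma iota_sum n (A : Delta n -> E) (x : Delta n) (z : Delta (A x)) :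
  iota (E_sum A) (existT _ x z) =
  existT _ (iota n x)
    (ext_eval_inv (@iota_embedding n) (F := fun x => K (A x)) (iota (A x) z)).
Proof. reflexivity. Qed.

(* Main.v *)
Require Import Defs.
From Stdlib Require Import Arith Lia Bool FunctionalExtensionality.

(** A root of a map into the two-point type is a point where it is [false].  Call
    a point [x0] a least-root candidate for [p : X -> bool] if the existence of a
    root anywhere makes [x0] a least root ([least_root_candidate]).  Unlike a least
    root, a candidate can be sought for every [p], so it makes sense to ask that
    an ordinal come with a map selecting one for each [p] ([selects_candidates]);
    this strengthening of compactness passes through the induction on codes
    without excluded middle, and non-emptiness of the complemented subset is only
    used at the very end: being a root is decidable, hence stable under double
    negation.

    The induction rests on three closure properties.  For the conaturals, the
    candidate is the length of the initial run of non-roots among the finite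
    conaturals ([conat_selects]); it works because a conatural that differs from
    every finite one is infinite.  For a lexicographic sum, one selects in every
    summand and then selects in the base ([sum_selects]).  The summand of a Sigma
    code over [k] is an extension, that is, a product indexed by a fibre of an
    embedding ([ext_selects]).  It cannot be decided whether that fibre is
    inhabited, but at an inhabitant the product is just one factor, while over an
    empty fibre it has a single point; this suffices, since that the chosen
    point is a root is an equation between booleans, which can be proved by
    contradiction, and a point strictly below it comes with an inhabitant of the
    fibre. *)

Definition least_root_candidate (X : Ord) (p : X -> bool) (x0 : X) : Prop :=
  forall x, p x = false -> p x0 = false /\ x0 ≼ x.

Definition selects_candidates (X : Ord) : Type :=
  forall p : X -> bool, {x0 : X | least_root_candidate X p x0}.

Lemma one_selects : selects_candidates one_ord.
Proof.
  intros p. exists tt. intros [] h. split; [exact h|]. intros [].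
Qed.

Lemma two_selects : selects_candidates two_ord.
Proof.
  intros p. destruct (p (inl tt)) eqn:e.
  - exists (inr tt). intros [[]|[]] h; [congruence|]. split; [exact h|]. intros [].
  - exists (inl tt). intros x _. split; [exact e|]. destruct x; intros [].
Qed.

Lemma conat_not_fin (u : conat) : (forall n, u <> fin n) -> u = infty.
Proof.
  intros H. apply conat_eq. intros i. cbn.
  induction i as [i IH] using lt_wf_ind.
  destruct (bits u i) eqn:e; [reflexivity|].
  destruct (H i). apply conat_eq. intros m. apply eq_true_iff_eq.
  rewrite bits_fin. split; intros h.
  - destruct (le_lt_dec i m) as [l|l]; [|exact l].
    rewrite (bits_mono l h) in e. discriminate.
  - exact (IH m h).
Qed.

Fixpoint true_upto (b : nat -> bool) (i : nat) : bool :=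
  match i with 0 => b 0 | S i => true_upto b i && b (S i) end.

Definition run (b : nat -> bool) : conat.
Proof.
  exists (true_upto b). intros i. cbn. destruct (true_upto b i), (b (S i)); reflexivity.
Defined.

Lemma bits_run (b : nat -> bool) (i : nat) :
  bits (run b) i = true <-> forall m, m <= i -> b m = true.
Proof.
  change (bits (run b) i) with (true_upto b i). induction i as [|i IH]; cbn.
  - split; intros h; [|apply h; lia]. intros m hm. replace m with 0 by lia. exact h.
  - rewrite andb_true_iff, IH. split.
    + intros [h h'] m hm. destruct (Nat.eq_dec m (S i)) as [->|ne]; [exact h'|].
      apply h. lia.
    + intros h. split; [intros m hm|]; apply h; lia.
Qed.

Lemma run_first_false (b : nat -> bool) (n : nat) :
  (forall m, m < n -> b m = true) -> b n = false -> run b = fin n.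
Proof.
  intros h e. apply conat_eq. intros i. apply eq_true_iff_eq.
  rewrite bits_run, bits_fin. split.
  - intros k. destruct (le_lt_dec n i) as [l|l]; [|exact l].
    rewrite (k n l) in e. discriminate.
  - intros l m hm. apply h. lia.
Qed.

Lemma run_all_true (b : nat -> bool) : (forall n, b n = true) -> run b = infty.
Proof.
  intros h. apply conat_eq. intros i. apply bits_run. intros m _. apply h.
Qed.

(** If [p] is [true] at the run of non-roots, then there is no finite root: at the
    first one the run would stop.  The run is then infinite, so the infinite point
    is not a root either, and by [conat_not_fin] no point is left to be one. *)
Lemma conat_selects : selects_candidates conat_ord.
Proof.
  intros p. set (b := fun n => p (fin n)). exists (run b). intros x hx. split.
  - destruct (p (run b)) eqn:e; [exfalso|reflexivity].
    assert (A : forall n, b n = true).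
    { intros n. induction n as [n IH] using lt_wf_ind.
      destruct (b n) eqn:en; [reflexivity|].
      rewrite (run_first_false b n IH en) in e. unfold b in en. congruence. }
    assert (ex : x = infty).
    { apply conat_not_fin. intros n ->. generalize (A n). unfold b. congruence. }
    rewrite (run_all_true b A) in e. congruence.
  - intros [n [-> h]]. rewrite bits_run in h.
    generalize (h n (le_n n)). unfold b. congruence.
Qed.

(** Minimising lexicographically: a summand contains a root exactly if its
    candidate is one, so the candidate in the base for the set of such summands
    finds the first of them. *)
Lemma sum_selects (T : TOrd) (U : T -> TOrd) :
  selects_candidates T -> (forall x, selects_candidates (U x)) ->
  selects_candidates (sum_tord U).
Proof.
  intros HT HU p.
  set (V := fun x => carrier (U x)).
  set (f := fun x => HU x (fun a => p (existT V x a))).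
  destruct (HT (fun x => p (existT V x (proj1_sig (f x))))) as [x0 H0].
  exists (existT V x0 (proj1_sig (f x0))). intros [x a] h.
  destruct (proj2_sig (f x) a h) as [hx la].
  destruct (H0 x hx) as [h0 lx]. split; [exact h0|].
  intros [l|[r l]]; cbn in *.
  - exact (lx l).
  - destruct r. exact (la l).
Qed.

(** The candidate takes at each point [q] of the fibre the value selected in the
    factor at [q], through the identification [fiber_tr] of that factor with the
    whole product. *)
Lemma ext_selects (X Y : Type) (j : X -> Y) (J : is_embedding j) (F : X -> TOrd) (k : Y) :
  (forall x, selects_candidates (F x)) -> selects_candidates (ext_tord J F k).
Proof.
  intros HF p.
  set (f := fun q : fiber j k => HF (projT1 q) (fun a => p (fiber_tr J a))).
  assert (tr : forall (u : ext_carrier j F k) q, fiber_tr J (u q) = u).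
  { intros u q. apply functional_extensionality_dep. intros q'.
    unfold fiber_tr. destruct (J k q q'). reflexivity. }
  set (u0 := (fun q => proj1_sig (f q)) : ext_carrier j F k).
  assert (at_q : forall u, p u = false -> forall q, p u0 = false /\ u0 q ≼ u q).
  { intros u h q. destruct (proj2_sig (f q) (u q)) as [h0 l].
    - rewrite tr. exact h.
    - fold (u0 q) in h0, l. rewrite tr in h0. split; assumption. }
  exists u0. intros u h. split.
  - destruct (p u0) eqn:e; [exfalso|reflexivity].
    (* An inhabitant of the fibre would make [u0] a root; so the fibre is empty
       and the product has no other point than [u0]. *)
    assert (eu : u = u0).
    { apply functional_extensionality_dep. intros q.
      destruct (at_q u h q). congruence. }
    congruence.
  - intros [q l]. exact (proj2 (at_q u h q) l).
Qed.

Lemma K_selects (n : E) : selects_candidates (K n).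
Proof.
  apply (E_elim (P := fun n => selects_candidates (K n))); clear n.
  - exact one_selects.
  - exact conat_selects.
  - intros n0 n1 H0 H1. apply (sum_selects two_tord (two_family (K n0) (K n1))).
    + exact two_selects.
    + intros [i|i]; assumption.
  - intros n0 n1 H0 H1. exact (sum_selects (K n0) (fun _ => K n1) H0 (fun _ => H1)).
  - intros n A H HA.
    apply (sum_selects (K n) (ext_tord (iota_embedding (n:=n)) (fun x => K (A x)))).
    + exact H.
    + intros k. apply ext_selects. exact HA.
Qed.

Theorem corollary7p6 (n : E) (p : K n -> bool)
    (hp : notT (notT {x : K n | p x = false})) :
  {x0 : K n | p x0 = false /\ forall x : K n, p x = false -> x0 ≼ x}.
Proof.
  destruct (K_selects n p) as [x0 H]. exists x0. split.
  - destruct (p x0) eqn:e; [exfalso|reflexivity].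
    apply hp. intros [x h]. destruct (H x h). congruence.
  - intros x h. exact (proj2 (H x h)).
Qed.
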